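(* Let $n\geq 3$ be a prime and let $t\ge 1$ be an integer. 1. If $n\equiv 1 \pmod 4$, then an $IH_t(n;3)$ exists if and only if $t\in\{1,2,n,2n\}$. 2. If $n\equiv 3 \pmod 4$, then an $IH_t(n;3)$ exists if and only if $t\in\{3,6,n,2n\}$.
   Context: Definition of a square integer relative Heffter array $IH_t(n;k)$: let $n,k,t$ be positive integers such that $t$ divides $2nk$ (this divisibility is part of the definition; if $t\nmid 2nk$ there is no $IH_t(n;k)$), put $v=2nk+t$, and let $J$ be the unique subgroup of $\mathbb{Z}_v$ of order $t$. An $IH_t(n;k)$ is an $n\times n$ partially filled array (cells may be empty) with entries in $\mathbb{Z}_v$, each entry being written as its representative of least absolute value (an integer of absolute value at most $v/2$), such that: (1) each row and each column contains exactly $k$ filled cells; (2) for every $x\in\mathbb{Z}_v\setminus J$, either $x$ or $-x$ appears in the array; (3) the entries in every row and every column, regarded as integers, sum to $0$ in $\mathbb{Z}$. (Since there are $nk$ filled cells and $|\mathbb{Z}_v\setminus J|=2nk$, exactly one of $x,-x$ appears, exactly once, for each $x\in\mathbb{Z}_v\setminus J$, and no element of $J$ appears.) *)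

(* Defs.v *)
From HB Require Import structures.
From mathcomp Require Import all_boot all_order all_algebra all_fingroup.

Set Implicit Arguments.
Unset Strict Implicit.
Unset Printing Implicit Defensive.

Import Order.TTheory GRing.Theory Num.Theory.

Local Open Scope ring_scope.

Definition heffter_modulus (n k t : nat) : nat := (2 * n * k + t)%N.

(* An n x n partially filled array of integers: [None] is an empty cell. *)
Definition pf_array (n : nat) := 'M[option int]_n.

Definition appears (n v : nat) (A : pf_array n) (x : 'Z_v) : Prop :=
  exists i j a, A i j = Some a /\ a%:~R = x.

(* The positivity assumptions give v > 2, so that 'Z_v really is Z/vZ.  Its   *)
(* finGroupType structure is the additive one; as Z/vZ is cyclic and t        *)
(* divides v, there is exactly one J of order t.  Entries are stored as       *)
(* integers and |a| <= v/2 is written 2|a| <= v.  An empty cell contributes 0 *)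
(* to the row and column sums.                                                *)
Definition is_IH (n k t : nat) (A : pf_array n) : Prop :=
  let v := heffter_modulus n k t in
  [/\ [/\ (0 < n)%N, (0 < k)%N, (0 < t)%N & (t %| 2 * n * k)%N],
      forall i j a, A i j = Some a -> 2 * `|a| <= v%:Z,
      (forall i, #|[set j | isSome (A i j)]| = k) /\
      (forall j, #|[set i | isSome (A i j)]| = k),
      exists J : {group 'Z_v}, #|J| = t /\
        (forall x : 'Z_v, x \notin J -> appears A x \/ appears A (- x)) &
      (forall i, \sum_j odflt 0 (A i j) = 0) /\
      (forall j, \sum_i odflt 0 (A i j) = 0)].

Definition IH_exists (t n k : nat) : Prop :=
  exists A : pf_array n, is_IH k t A.

(* Main.v *)
Require Import Defs.
From mathcomp Require Import all_boot all_order all_algebra all_fingroup.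
From mathcomp Require Import cyclic zify ring.

(** Put v = 6n + t = q t, so that J consists of the multiples of q.  Lifted to
    the integers, an array with three cells in each row and column and with zero
    row and column sums is an IH_t(n;3) exactly when the absolute values of its
    entries are the integers of [1, v/2] not divisible by q.

    Necessity.  There are 3n such integers, hence each of them is the absolute
    value of exactly one entry.  As the entries sum to 0, the integers
    themselves have an even sum (lemma IH_abs_sum_even).  With V = v/2 and
    h = t/2, both rounded down, twice that sum is V (V + 1) - q h (h + 1).
    The divisibility t | 6n with n prime leaves t = s or t = s n for s in
    {1, 2, 3, 6}, and reducing modulo 4 excludes exactly the values of t that are
    missing from the statement.

    Sufficiency.  Put the filled cells on three cyclically consecutive
    diagonals.  The zero-sum conditions then force the row i to be
    a_i, d - a_i - a_(i+1), a_(i+1) - d for a cyclic sequence a and a constant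
    d, and conversely any such choice has zero sums.  So it is enough to find a
    and d for which the numbers |a_i|, |a_i - d|, |a_i + a_(i+1) - d| fill the
    required set (lemma cyclic_array_IH).  Write n = 2m + 1.

    - For t = n and t = 2n the required numbers are those of the form
      |M k + r| with |k| <= m and r = 1, 2, 3, where M = 7, respectively 8.
      Take d = 1 and a_i = M x_i + 2, where x lists the integers of [-m, m] by
      steps of m + 1 modulo n: the sums x_i + x_(i+1) again take each value of
      [-m, m] once (lemma progression_IH).

    - For t = 1, 2, 3, 6 the required numbers are 1, ..., n together with the
      2n numbers that lie in two blocks of length n, symmetric about a centre
      d/2.  Take a_i = d/2 +- y_i, where y is the zigzag that starts near the
      middle of its range and moves out; then a_i and a_i - d fill the two
      blocks.  With alternating signs the consecutive pairs of terms give
      1, 2, ..., 2m, but the pair that closes the odd cycle has equal signs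
      and gives too large a number.  Breaking the alternation once, in the
      middle, replaces the value m there by n; the closing pair now has
      opposite signs and supplies m.  This works for a centre of the right
      parity: half an odd integer if n = 1 modulo 4, an integer if n = 3
      modulo 4 (lemma zigzag_IH). *)

(** * Integers and residues *)

Section Modulus.
Import Order.TTheory GRing.Theory Num.Theory.
Local Open Scope ring_scope.

Lemma intr_Zp_eq0 (v : nat) (a : int) :
  (1 < v)%N -> (a%:~R == 0 :> 'Z_v) = (v %| `|a|)%N.
Proof.
move=> v_gt1.
have natE (m : nat) : (m%:R == 0 :> 'Z_v) = (v %| m)%N.
  by rewrite -val_eqE /= val_Zp_nat.
by case: a => m; rewrite ?NegzE ?mulrNz ?oppr_eq0 ?abszN natE.
Qed.

(** Since v divides a - m or a + m, and both are at most v in absolute value,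
    the only case besides a = m and a = -m is that of the residue v/2, where
    |a| = m still holds. *)
Lemma opp_pair_absz {v m : nat} {a : int} :
  (1 < v)%N -> (0 < m)%N -> (2 * m <= v)%N -> 2 * `|a| <= v%:Z ->
  (a%:~R = m%:R :> 'Z_v \/ a%:~R = - m%:R :> 'Z_v) <-> `|a|%N = m.
Proof.
move=> v_gt1 m_gt0 mv av; split=> [eq_am | <-].
  have dvd_small b : (v %| `|b|)%N -> (`|b| <= v)%N -> b = 0 \/ `|b|%N = v.
    case/dvdnP=> -[|[|k]] bE b_le; [left | right | exfalso]; nia.
  have [eqm | eqm] := eq_am.
    have: (v %| `|(a - m%:Z)%R|)%N.
      by rewrite -intr_Zp_eq0 // rmorphB /= eqm subrr.
    by move/dvd_small; lia.
  have: (v %| `|(a + m%:Z)%R|)%N.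
    by rewrite -intr_Zp_eq0 // rmorphD /= eqm addNr.
  by move/dvd_small; lia.
by case: (intP a) => [|k|k]; [left | left | right]; rewrite ?mulrNz ?abszN.
Qed.

Lemma natr_mem_group {q t m : nat} {J : {group 'Z_(q * t)}} :
  (1 < q * t)%N -> #|J| = t -> m%:R \in J -> (q %| m)%N.
Proof.
move=> v_gt1 cardJ mJ.
have t_gt0 : (0 < t)%N by rewrite -cardJ cardG_gt0.
have := order_dvdG mJ; rewrite cardJ order_dvdn FinRing.zmodXgE -mulrnA.
have -> : 1%g = 0 :> 'Z_(q * t) by [].
by rewrite -[_%:R]/((m * t)%N%:~R) intr_Zp_eq0 //= dvdn_pmul2r.
Qed.

Lemma Zp_group_of_order {q t : nat} :
  (1 < q * t)%N ->
  exists J : {group 'Z_(q * t)},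
    #|J| = t /\ forall x : 'Z_(q * t), (q %| x)%N -> x \in J.
Proof.
move=> v_gt1; have q_gt0 : (0 < q)%N by case: q v_gt1.
exists <[((1%R : 'Z_(q * t)) ^+ q)%g]>%G; split.
  have o1 : #[1%R : 'Z_(q * t)]%g = (q * t)%N.
    by rewrite -[RHS]Zp_cast //; apply: order_Zp1.
  have := orderXdiv (a := 1%R : 'Z_(q * t)) (n := q).
  by rewrite o1 orderE mulKn // => -> //; apply: dvdn_mulr.
move=> x /dvdnP[s xE]; rewrite -[x]natr_Zp xE (mulnC s).
rewrite -[_%:R]FinRing.zmodXgE expgM.
exact: mem_cycle.
Qed.

End Modulus.

(** * Arrays supported on three cyclic diagonals *)

Section CyclicArray.
Import Order.TTheory GRing.Theory Num.Theory.
Local Open Scope ring_scope.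

(** Every row and every column of the arrays below has its three cells at
    explicit places; this lemma serves both. *)
Lemma three_cells (n : nat) (f : 'I_n -> option int) (i0 i1 i2 : 'I_n)
    (x0 x1 x2 : int) :
  uniq [:: i0; i1; i2] ->
  f i0 = Some x0 -> f i1 = Some x1 -> f i2 = Some x2 ->
  (forall j, j \notin [:: i0; i1; i2] -> f j = None) ->
  #|[set j | isSome (f j)]| = 3 /\ \sum_j odflt 0 (f j) = x0 + x1 + x2.
Proof.
move=> uniq_i f0 f1 f2 fN.
have fE j : isSome (f j) = (j \in [:: i0; i1; i2]).
  have [|/fN-> //] := boolP (j \in _).
  by rewrite !inE => /or3P[] /eqP->; rewrite ?f0 ?f1 ?f2.
split.
  by rewrite -[RHS](card_uniqP uniq_i); apply: eq_card => j; rewrite inE fE.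
rewrite (bigID (mem [:: i0; i1; i2])) /= [X in _ + X]big1 => [|j /fN-> //].
by rewrite addr0 -big_uniq // !big_cons big_nil f0 f1 f2 /= addr0 addrA.
Qed.

Lemma succ_modE {n i : nat} :
  (i < n)%N -> (i.+1 %% n = if i.+1 == n then 0 else i.+1)%N.
Proof.
by case: eqP => [<-|? ?]; [rewrite modnn | rewrite modn_small //; lia].
Qed.

Lemma pred_modE {n i : nat} :
  (i < n)%N -> ((i + n).-1 %% n = if i == 0 then n.-1 else i.-1)%N.
Proof.
case: i => [|i] lt_in /=; first by rewrite modn_small //; lia.
by rewrite modnDr modn_small //; lia.
Qed.

(** With x_i in (i, i-1) and z_i in (i, i+1), comparing the sums of row i and
    column i shows that z_i - x_(i+1) does not depend on i; this constant is
    -d, and the diagonal entry is determined by the row sum. *)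
Definition cyclic_array (n : nat) (a : nat -> int) (d : int) : pf_array n :=
  \matrix_(i, j)
    if j == i then Some (d - (a i + a (ordS i)))
    else if j == ord_pred i then Some (a i)
    else if j == ordS i then Some (a (ordS i) - d)
    else None.

(** All sums vanish identically, since row j and column j contain the same
    diagonal entry and, up to moving d, the same pair a_j, a_(j+1).  What is left
    is a covering problem for the sequence a. *)
Lemma cyclic_array_IH (n t q : nat) (a : nat -> int) (d : int) :
  (2 < n)%N -> (0 < t)%N -> (t %| 2 * n * 3)%N ->
  (q * t)%N = (2 * n * 3 + t)%N ->
  (forall i, (i < n)%N ->
     [/\ 2 * `|a i| <= (q * t)%:Z, 2 * `|a i - d| <= (q * t)%:Z
       & 2 * `|a i + a (i.+1 %% n)%N - d| <= (q * t)%:Z]) ->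
  (forall m, (0 < m)%N -> (2 * m <= q * t)%N -> ~~ (q %| m)%N ->
     exists2 i, (i < n)%N
       & [\/ `|a i| = m, `|a i - d| = m | `|a i + a (i.+1 %% n)%N - d| = m]) ->
  IH_exists t n 3.
Proof.
move=> n_gt2 t_gt0 t_dvd qt bound cover.
have v_gt1 : (1 < q * t)%N by lia.
have nb (i : 'I_n) : uniq [:: i; ord_pred i; ordS i].
  rewrite /= !inE -!val_eqE /=.
  have := succ_modE (ltn_ord i); have := pred_modE (ltn_ord i).
  move: (_ %% n)%N (_ %% n)%N => x y; move: (nat_of_ord i) (ltn_ord i) => k.
  by case: ifP => /eqP ? ?; case: ifP => /eqP ?; lia.
have rowP (i : 'I_n) :
    #|[set j | isSome (cyclic_array n a d i j)]| = 3
      /\ \sum_j odflt 0 (cyclic_array n a d i j) = 0.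
  have := nb i; rewrite /= !inE negb_or => /and3P[/andP[ip is_] ps _].
  have [||||j|-> ->] := @three_cells _ (cyclic_array n a d i)
      i (ord_pred i) (ordS i) (d - (a i + a (ordS i))) (a i) (a (ordS i) - d);
    rewrite ?nb ?mxE //; last by split=> //; ring.
  - by rewrite eqxx.
  - by rewrite eq_sym (negPf ip) eqxx.
  - by rewrite eq_sym (negPf is_) eq_sym (negPf ps) eqxx.
  - by rewrite !inE => /norP[/negPf-> /norP[/negPf-> /negPf->]].
have colP (j : 'I_n) :
    #|[set i | isSome (cyclic_array n a d i j)]| = 3
      /\ \sum_i odflt 0 (cyclic_array n a d i j) = 0.
  have := nb j; rewrite /= !inE negb_or => /and3P[/andP[jp js] ps _].
  have [||||i|-> ->] := @three_cells _ (fun i => cyclic_array n a d i j)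
      j (ordS j) (ord_pred j) (d - (a j + a (ordS j))) (a (ordS j)) (a j - d);
    rewrite ?mxE //; last by split=> //; ring.
  - by rewrite /= !inE negb_or jp js eq_sym ps.
  - by rewrite eqxx.
  - by rewrite (negPf js) ordSK eqxx.
  - rewrite (negPf jp) ord_predK eqxx.
    have := nb (ord_pred j); rewrite ord_predK /= !inE => /and3P[_ /negPf].
    by rewrite eq_sym => ->.
  - rewrite !inE => /norP[/negPf ij /norP[iS iP]].
    rewrite eq_sym ij -(can2_eq (@ordSK n) (@ord_predK n)).
    rewrite -[j == ordS i](can2_eq (@ord_predK n) (@ordSK n)).
    by rewrite eq_sym (negPf iS) eq_sym (negPf iP).
have entry i j x : cyclic_array n a d i j = Some x -> 2 * `|x| <= (q * t)%:Z.
  have [b0 b1 b2] := bound i (ltn_ord i).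
  have [_ b3 _] := bound (ordS i) (ltn_ord (ordS i)).
  rewrite mxE; case: ifP => _; last case: ifP => _; last case: ifP => _ //.
  - by case=> <-; rewrite distrC.
  - by case=> <-.
  - by case=> <-.
exists (cyclic_array n a d); rewrite /is_IH /heffter_modulus -qt.
split=> //.
- by split; lia.
- by split=> [i|j]; [case: (rowP i) | case: (colP j)].
- have [J [cardJ memJ]] := Zp_group_of_order v_gt1.
  exists J; split=> // x xJ.
  have q_ndvd : ~~ (q %| x)%N by apply: contra xJ; apply: memJ.
  (* m is the representative of x or of - x that is at most v/2. *)
  have [m [m_gt0 m_le m_ndvd mx]] : exists m, [/\ (0 < m)%N, (2 * m <= q * t)%N,
      ~~ (q %| m)%N & m%:R = x \/ m%:R = - x].
    have x_gt0 : (0 < x)%N by case: (nat_of_ord x) q_ndvd => //; rewrite dvdn0.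
    have x_lt : (x < q * t)%N by rewrite -[X in (_ < X)%N](Zp_cast v_gt1).
    have [le_xv | lt_vx] := leqP (2 * x) (q * t).
      by exists x; split=> //; left; rewrite natr_Zp.
    exists (q * t - x)%N; split; [lia | lia | | right].
      by rewrite dvdn_subr ?dvdn_mulr // ltnW.
    by rewrite natrB ?(ltnW x_lt) // natr_Zp pchar_Zp // sub0r.
  have [i lt_in i_m] := cover m m_gt0 m_le m_ndvd.
  have [i1 [j1 [b [Ab bm]]]] :
      exists i1 j1 b, cyclic_array n a d i1 j1 = Some b /\ `|b|%N = m.
    have := nb (Ordinal lt_in); set io := Ordinal lt_in.
    rewrite /= !inE negb_or => /and3P[/andP[ip is_] ps _].
    case: i_m => bm.
    - exists io, (ord_pred io), (a i); split; last by lia.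
      by rewrite mxE eq_sym (negPf ip) eqxx.
    - exists (ord_pred io), io, (a i - d); split; last by lia.
      rewrite mxE ord_predK (negPf ip) eqxx.
      have := nb (ord_pred io); rewrite ord_predK /= !inE => /and3P[_ /negPf].
      by rewrite eq_sym => ->.
    exists io, io, (d - (a i + a (i.+1 %% n)%N)); split; last by lia.
    by rewrite mxE eqxx.
  have [_ /(_ bm)] := opp_pair_absz v_gt1 m_gt0 m_le (entry _ _ _ Ab).
  have app c : b%:~R = c -> appears (cyclic_array n a d) c by exists i1, j1, b.
  by case: mx => -> [] bx; [left | right | right | left];
    apply: app; rewrite bx ?opprK.
- by split=> [i|j]; [case: (rowP i) | case: (colP j)].
Qed.

End CyclicArray.

(** * Two cyclic sequences *)

Section Sequences.
Import Order.TTheory GRing.Theory Num.Theory.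
Local Open Scope ring_scope.

(** The integers of [-m, m] in the cyclic order 0, -m, 1, -m+1, 2, ..., -1, m,
    that is, i / 2 modulo 2m + 1 for i = 0, ..., 2m.  Consecutive terms
    therefore sum to the successive residues i - m. *)
Definition half_steps (m i : nat) : int :=
  if odd i then (i./2)%:Z - m%:Z else (i./2)%:Z.

Lemma half_steps_bound {m i : nat} :
  (i < m.*2.+1)%N -> `|half_steps m i| <= m%:Z.
Proof. by rewrite /half_steps; case: ifP; lia. Qed.

Lemma half_steps_onto {m : nat} {k : int} :
  `|k| <= m%:Z -> exists2 i, (i < m.*2.+1)%N & half_steps m i = k.
Proof.
case: k => k k_le; [exists k.*2 | exists (m - k.+1).*2.+1]; rewrite /half_steps;
  try lia.
- by rewrite odd_double doubleK.
- by rewrite /= odd_double /= uphalf_double; lia.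
Qed.

Lemma half_steps_sum {m i : nat} :
  (i < m.*2.+1)%N ->
  half_steps m i + half_steps m (i.+1 %% m.*2.+1)%N
    = if i == m.*2 then m%:Z else i%:Z - m%:Z.
Proof.
move=> lt_i; rewrite (succ_modE lt_i) eqSS /half_steps.
case: eqP => [->|ne_i]; first by rewrite odd_double doubleK /=; lia.
by rewrite /=; case: (boolP (odd i)) => odd_i /=; lia.
Qed.

(** The labels are M k + 1, M k + 2 and M k + 3 with M = 6 + s and |k| <= m:
    the first two from a_i - d and a_i, the last from the sums.  Up to sign
    they exhaust the classes modulo M other than 0 and, for M = 8, other
    than 4.  The group J has index 7 for s = 1, and index 4 for s = 2. *)
Lemma progression_IH (m n s : nat) :
  n = m.*2.+1 -> (0 < m)%N -> s = 1 \/ s = 2 -> IH_exists (s * n) n 3.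
Proof.
move=> nE m_gt0 s12.
have qt : ((if s == 1 then 7 else 4) * (s * n) = 2 * n * 3 + s * n)%N.
  by case: s12 => -> /=; lia.
pose a i := (6 + s)%:Z * half_steps m i + 2.
have aS i : (i < n)%N ->
    a i + a (i.+1 %% n)%N - 1
      = (6 + s)%:Z * (if i == m.*2 then m%:Z else i%:Z - m%:Z) + 3.
  by move=> lt_i; rewrite nE -half_steps_sum -?nE // /a; ring.
apply: (@cyclic_array_IH n (s * n) _ a 1) qt _ _ => [||||l l_gt0 l_le l_ndvd].
- by lia.
- by case: s12 => ->; lia.
- by case: s12 => ->; [apply/dvdnP; exists 6 | apply/dvdnP; exists 3]; lia.
- move=> i lt_i; rewrite aS // /a; rewrite nE in lt_i; have := half_steps_bound lt_i.
  by case: s12 => -> /=; case: (eqVneq i m.*2) => ?; split; lia.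
(* Division by M, reflecting the remainders above M / 2. *)
have [r [k [r123 k_le l_rk]]] : exists r k : int, [/\ r = 1 \/ r = 2 \/ r = 3,
    `|k| <= m%:Z & `|(6 + s)%:Z * k + r| = l%:Z].
  have rem_lt4 : (l %% (6 + s) < 4 \/ 6 + s - 4 < l %% (6 + s))%N.
    by case: s12 l_ndvd => -> /=; lia.
  have [lt4 | gt4] := rem_lt4.
    exists (l %% (6 + s))%N%:Z, (l %/ (6 + s))%N%:Z.
    by case: s12 l_le l_ndvd lt4 => -> /=; split; lia.
  exists (6 + s - l %% (6 + s))%N%:Z, (- (l %/ (6 + s)).+1%:Z).
  by case: s12 l_le l_ndvd gt4 => -> /=; split; lia.
case: r123 l_rk => [->|[->|->]] l_rk.
- have [i lt_i ik] := half_steps_onto k_le.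
  by exists i; rewrite ?nE //; constructor 2; rewrite /a ik -l_rk; congr `|_|; ring.
- have [i lt_i ik] := half_steps_onto k_le.
  by exists i; rewrite ?nE //; constructor 1; rewrite /a ik -l_rk.
(* The sum M k + 3 comes from i = k + m, except k = m from the closing pair. *)
have [eq_km | ne_km] := eqVneq k m%:Z.
  exists m.*2; first by lia.
  constructor 3; rewrite aS; last by lia.
  by rewrite eqxx -eq_km l_rk.
exists `|(k + m%:Z)%R|%N; first by lia.
constructor 3; rewrite aS; last by lia.
rewrite ifF; last by lia.
by rewrite -l_rk; congr `|_ * _ + _|; lia.
Qed.

(** The permutation m+1, m, m+2, m-1, m+3, ..., 1, 2m+1 of [1, 2m+1]: it moves
    out from the middle, with consecutive differences 1, 2, ..., 2m. *)
Definition zigzag (m i : nat) : nat :=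
  if odd i then (m - i./2)%N else (m.+1 + i./2)%N.

(** True where the sign is negative: signs alternate, except that m - 1 and m
    carry the same sign, so that this pair contributes its sum instead of
    its difference m. *)
Definition zigzag_turned (m i : nat) : bool := odd i (+) (m <= i)%N.

Lemma zigzag_bound {m i : nat} :
  (0 < m)%N -> (i < m.*2.+1)%N -> (0 < zigzag m i <= m.*2.+1)%N.
Proof. by rewrite /zigzag; case: ifP; lia. Qed.

Lemma zigzag_onto {m u : nat} :
  (0 < u <= m.*2.+1)%N -> exists2 i, (i < m.*2.+1)%N & zigzag m i = u.
Proof.
move=> u_le; have [lt_mu | le_um] := ltnP m u.
  by exists (u - m.+1).*2; rewrite /zigzag ?odd_double ?doubleK; lia.
exists (m - u).*2.+1; first by lia.
by rewrite /zigzag /= odd_double /= uphalf_double; lia.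
Qed.

(** The two blocks are p + u and p' - u for u in [1, 2m+1], with centre
    (p + p')/2, where p' = p + 1 if m is even and p' = p if m is odd. *)
Definition centered_zigzag (p m i : nat) : int :=
  if zigzag_turned m i then (p + ~~ odd m)%:Z - (zigzag m i)%:Z
  else p%:Z + (zigzag m i)%:Z.

(** At the unbroken pairs the difference i + 1 of the zigzag appears.  At the
    pair (m-1, m) the two zigzag values sum to 2m + 1 if m is odd and to 2m + 2
    if m is even, and the choice of the centre reduces both to 2m + 1.  The
    closing pair joins m + 1 and 2m + 1 with opposite signs and gives m. *)
Lemma centered_zigzag_sum {p m i : nat} :
  (0 < m)%N -> (i < m.*2.+1)%N ->
  `|centered_zigzag p m i + centered_zigzag p m (i.+1 %% m.*2.+1)%N
     - (p.*2 + ~~ odd m)%:Z|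
  = (if i == m.*2 then m else if i.+1 == m then m.*2.+1 else i.+1)%N.
Proof.
move=> m_gt0 lt_i; rewrite (succ_modE lt_i) eqSS.
rewrite /centered_zigzag /zigzag_turned /zigzag.
case: eqP => [->|ne_i].
  rewrite odd_double doubleK /= leqn0 (gtn_eqF m_gt0) -addnn leq_addr /=.
  by case: (boolP (odd m)) => ? /=; lia.
case: eqP => [eq_im|ne_im] /=.
  rewrite -eq_im leqnn ltnn /=; case: (boolP (odd i)) => ? /=; lia.
have -> : (m <= i.+1)%N = (m <= i)%N by lia.
case: (boolP (odd i)) => ? /=; case: (boolP (odd m)) => ? /=;
  by case: leqP => ? /=; lia.
Qed.

(** Here 1, ..., n come from the sums, and the two blocks from a_i and
    a_i - d. *)
Lemma zigzag_IH (p m n q t : nat) :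
  n = m.*2.+1 -> (0 < m)%N -> (n <= p)%N -> (0 < t)%N -> (t %| 2 * n * 3)%N ->
  (q * t)%N = (2 * n * 3 + t)%N -> (2 * (p + n) <= q * t)%N ->
  (forall l, (0 < l)%N -> (2 * l <= q * t)%N -> ~~ (q %| l)%N ->
     [\/ (l <= n)%N, (p < l <= p + n)%N
       | (p + ~~ odd m <= l + n /\ l < p + ~~ odd m)%N]) ->
  IH_exists t n 3.
Proof.
move=> nE m_gt0 le_np t_gt0 t_dvd qt le_pn cover.
apply: (@cyclic_array_IH n t q (centered_zigzag p m) (p.*2 + ~~ odd m)%:Z)
  => // [|i lt_i|l l_gt0 l_le l_ndvd].
- by lia.
- rewrite nE in lt_i *.
  have := centered_zigzag_sum (p := p) m_gt0 lt_i; move=> ->.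
  have := zigzag_bound m_gt0 lt_i; rewrite /centered_zigzag.
  split; try (by case: ifP; lia).
  by case: (eqVneq i m.*2) => ?; case: (eqVneq i.+1 m) => ?; lia.
have sum i l' : (i < n)%N ->
    (if i == m.*2 then m else if i.+1 == m then n else i.+1) = l' ->
    `|centered_zigzag p m i + centered_zigzag p m (i.+1 %% n)%N
        - (p.*2 + ~~ odd m)%:Z| = l'.
  by move=> lt_i <-; rewrite nE in lt_i *; rewrite centered_zigzag_sum.
have [l_n | l_pn | l_np] := cover l l_gt0 l_le l_ndvd.
- have [l_eqn | l_neqn] := eqVneq l n.
    exists m.-1; first by lia.
    constructor 3; apply: sum; first by lia.
    by rewrite prednK // eqxx ifF; lia.
  have [l_eqm | l_neqm] := eqVneq l m.
    exists m.*2; first by lia.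
    constructor 3; apply: sum; first by lia.
    by rewrite eqxx.
  exists l.-1; first by lia.
  by constructor 3; apply: sum; rewrite prednK // ?ifF; lia.
- have [|i lt_i zi] := @zigzag_onto m (l - p); first by lia.
  exists i; rewrite ?nE // /centered_zigzag zi.
  by case: (zigzag_turned m i); [constructor 2 | constructor 1]; lia.
have [|i lt_i zi] := @zigzag_onto m (p + ~~ odd m - l); first by lia.
exists i; rewrite ?nE // /centered_zigzag zi.
by case: (zigzag_turned m i); [constructor 1 | constructor 2]; lia.
Qed.

End Sequences.

(** * The parity obstruction *)

Section Necessity.
Import Order.TTheory GRing.Theory Num.Theory.
Local Open Scope ring_scope.

Lemma sum_multiples (q V : nat) :
  (0 < q)%N ->
  (2 * (\sum_(1 <= l < V.+1 | q %| l) l) = q * (V %/ q) * (V %/ q).+1)%N.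
Proof.
move=> q_gt0; elim: V => [|V IH]; first by rewrite big_geq // div0n; lia.
rewrite big_mkcond big_nat_recr //= -big_mkcond mulnDr IH divnS //.
case: (boolP (q %| V.+1)%N) => [/dvdnP[k kE] | _] /=; last by rewrite addn0.
by have := divnS V q_gt0; rewrite kE mulnK // dvdn_mull //= => ->; nia.
Qed.

Lemma sum_nonmultiples (q V : nat) :
  (0 < q)%N ->
  (2 * (\sum_(1 <= l < V.+1 | ~~ (q %| l)) l) + q * (V %/ q) * (V %/ q).+1
     = V * V.+1)%N.
Proof.
move=> q_gt0; rewrite -sum_multiples // -mulnDr.
have := sum_multiples 1 V isT; rewrite divn1 mul1n => <-.
congr (2 * _)%N; rewrite [RHS](eq_bigl xpredT) => [|l]; last by rewrite dvd1n.
by rewrite [RHS](bigID (fun l => q %| l)%N) /= addnC.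
Qed.

(** The interval [1, v/2] contains exactly 3n integers outside J: it has
    3n + t/2 elements, of which t/2 (rounded down) are multiples of q. *)
Lemma half_modulus (n t q : nat) :
  (0 < t)%N -> (q * t)%N = (2 * n * 3 + t)%N ->
  ((q * t)./2 = n * 3 + t./2 /\ (q * t)./2 %/ q = t./2)%N.
Proof.
move=> t_gt0 qt; have q_gt0 : (0 < q)%N by case: q qt; lia.
split; first by lia.
have [tE | tE] : t = t./2.*2 \/ t = t./2.*2.+1 by lia.
  by rewrite {1}tE -doubleMr doubleK mulKn.
rewrite {1}tE mulnS -doubleMr halfD odd_double andbF add0n doubleK addnC.
by rewrite mulnC divnMDl // divn_small ?addn0 //; lia.
Qed.

(** The 3n cells must cover 3n integers, so the absolute values of the entries
    are these integers, each once; modulo 2 their sum agrees with the sum of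
    the entries, which is 0. *)
Lemma IH_abs_sum_even (n t q : nat) :
  (q * t)%N = (2 * n * 3 + t)%N -> IH_exists t n 3 ->
  ~~ odd (\sum_(1 <= l < (q * t)./2.+1 | ~~ (q %| l)) l)%N.
Proof.
move=> qt [A]; rewrite /is_IH /heffter_modulus -qt => -[].
move=> [n_gt0 _ t_gt0 t_dvd] bound [rowk colk] [J [cardJ memJ]] [row0 col0].
have v_gt1 : (1 < q * t)%N by lia.
have q_gt0 : (0 < q)%N by case: q qt {bound J cardJ memJ v_gt1}; lia.
have [V_eq V_div] := half_modulus n t q t_gt0 qt.
set V := (q * t)./2 in V_eq V_div *.
pose L := [seq l <- index_iota 1 V.+1 | ~~ (q %| l)%N].
pose C := [set ij : 'I_n * 'I_n | isSome (A ij.1 ij.2)].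
pose f (ij : 'I_n * 'I_n) := `|(odflt 0 (A ij.1 ij.2))%R|%N.
have cardC : #|C| = (n * 3)%N.
  rewrite -sum1dep_card.
  rewrite -(pair_big_dep xpredT (fun i j => isSome (A i j)) (fun _ _ => 1%N)) /=.
  rewrite (eq_bigr (fun=> 3)) => [|i _]; first by rewrite sum_nat_const card_ord.
  by rewrite sum1dep_card.
have sizeL : size L = (n * 3)%N.
  rewrite size_filter.
  have := count_predC (fun l => q %| l)%N (index_iota 1 V.+1).
  rewrite size_iota -[X in (X + _)%N]sum1_count big_mkcond -divn_count_dvd V_div.
  by rewrite [count (predC _) _]/(count _ _) subn1 V_eq /=; lia.
have L_sub : {subset L <= [seq f ij | ij <- enum C]}.
  move=> l; rewrite mem_filter mem_index_iota => /andP[l_ndvd /andP[l_gt0 l_le]].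
  have l2_le : (2 * l <= q * t)%N by rewrite /V in l_le; lia.
  have lJ : l%:R \notin J by apply: contra l_ndvd; apply: natr_mem_group.
  have [i [j [a [Aa al]]]] : exists i j a, A i j = Some a /\ `|a|%N = l.
    by case: (memJ _ lJ) => -[i [j [a [Aa ax]]]]; exists i, j, a; split=> //;
      apply/(opp_pair_absz v_gt1 l_gt0 l2_le (bound _ _ _ Aa)); [left | right].
  by apply/mapP; exists (i, j); rewrite /f ?mem_enum ?inE /= Aa.
have [_ L_eq] : (size L = size [seq f ij | ij <- enum C])
    * (L =i [seq f ij | ij <- enum C]).
  apply: uniq_min_size => //; first by rewrite filter_uniq ?iota_uniq.
  by rewrite size_map -cardE cardC sizeL.
have L_perm : perm_eq L [seq f ij | ij <- enum C].
  apply: uniq_perm => //; first by rewrite filter_uniq ?iota_uniq.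
  rewrite -(eq_uniq _ L_eq) ?filter_uniq ?iota_uniq //.
  by rewrite size_map -cardE cardC sizeL.
rewrite -big_filter (perm_big _ L_perm) big_map big_enum /=.
have odd_sum (I : finType) (P : pred I) (F : I -> int) :
    odd (\sum_(i | P i) `|F i|%N)%N = odd `|(\sum_(i | P i) F i)%R|%N.
  by apply: (big_rec2 (fun x y => odd x = odd `|y|%N)) => // i x y _; lia.
rewrite odd_sum big_mkcond /=.
rewrite (eq_bigr (fun ij => odflt 0 (A ij.1 ij.2))) => [|ij _]; last first.
  by rewrite inE; case: (A _ _).
rewrite -(pair_bigA _ (fun i j => odflt 0 (A i j))) /= big1 //.
Qed.

Lemma IH_parity {n t : nat} :
  IH_exists t n 3 ->
  (t %| 6 * n)%N /\
  exists q z, (q * t = 6 * n + t)%N /\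
    (4 * z + q * t./2 * t./2.+1 = (n * 3 + t./2) * (n * 3 + t./2).+1)%N.
Proof.
move=> IH; have [A [[_ _ t_gt0 t_dvd] _ _ _ _]] := IH.
have dvd6n : (t %| 6 * n)%N by rewrite (_ : 6 * n = 2 * n * 3)%N; lia.
split=> //; have /dvdnP[k kE] := dvd6n.
have qt : (k.+1 * t)%N = (2 * n * 3 + t)%N by rewrite mulSn -kE; lia.
have /negPf S_even := IH_abs_sum_even n t k.+1 qt IH.
have [V_eq V_div] := half_modulus n t k.+1 t_gt0 qt.
have := sum_nonmultiples k.+1 (k.+1 * t)./2 isT.
move: S_even; rewrite V_eq in V_div *; rewrite V_div.
set S := (\sum_(_ <= _ < _ | _) _)%N => S_even <-.
by exists k.+1, S./2; split; [lia | congr (_ + _)%N; lia].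
Qed.

End Necessity.

Lemma dvdn_6_prime {n t : nat} :
  prime n -> t %| 6 * n ->
  exists2 s, s \in [:: 1; 2; 3; 6] & t = s \/ t = s * n.
Proof.
move=> n_prime; have div6 s : s %| 6 -> s \in [:: 1; 2; 3; 6].
  by move=> s6; rewrite -[_ :: _]/(divisors 6) -dvdn_divisors.
have [n_t | n_nt] := boolP (n %| t).
  case/dvdnP: n_t => s ->; rewrite dvdn_pmul2r ?prime_gt0 // => /div6 s6.
  by exists s => //; right.
rewrite Gauss_dvdl; last by rewrite coprime_sym prime_coprime.
by move=> /div6 t6; exists t => //; left.
Qed.

Theorem theorem1p6 (n t : nat) (hn3 : 3 <= n) (hnp : prime n) (ht : 1 <= t) :
  (n = 1 %[mod 4] -> (IH_exists t n 3 <-> t \in [:: 1; 2; n; 2 * n])) /\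
  (n = 3 %[mod 4] -> (IH_exists t n 3 <-> t \in [:: 3; 6; n; 2 * n])).
Proof.
have prog : odd n -> t = n \/ t = 2 * n -> IH_exists t n 3.
  move=> odd_n t_n; have nE : n = n./2.*2.+1 by lia.
  have [s [s12 ->]] : exists s, (s = 1 \/ s = 2) /\ t = s * n.
    by case: t_n => ->; [exists 1 | exists 2]; split; lia.
  by apply: progression_IH nE _ s12; lia.
have q_uniq q q' : q * t = q' * t -> q = q'.
  by move=> /eqP; rewrite eqn_pmul2r // => /eqP.
have not_multiple q l : ~~ (q %| l) -> forall c, l <> c * q.
  by move=> q_l c lE; rewrite lE dvdn_mull in q_l.
have zz p q : n <= p -> t %| 2 * n * 3 -> q * t = 2 * n * 3 + t ->
    2 * (p + n) <= q * t ->
    (forall l, 0 < l -> 2 * l <= q * t -> (forall c, l <> c * q) ->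
      [\/ l <= n, p < l <= p + n
        | p + ~~ odd n./2 <= l + n /\ l < p + ~~ odd n./2]) ->
    odd n -> IH_exists t n 3.
  move=> le_np t_dvd qt le_pn cover odd_n.
  have nE : n = n./2.*2.+1 by lia.
  apply: (@zigzag_IH p n./2 n q t) => //; first by lia.
  by move=> l l_gt0 l_le /not_multiple; apply: cover.
split=> n_mod; split.
- move=> /IH_parity[t_dvd [q [z [qt z_eq]]]].
  have [s s6 t_s] := dvdn_6_prime hnp t_dvd.
  have [a nE] : exists a, n = 4 * a + 1 by exists (n %/ 4); lia.
  (* In every excluded case V (V + 1) - q h (h + 1) is 2 modulo 4. *)
  rewrite !inE; move: s6 t_s; rewrite !inE => /or4P[] /eqP-> [] tE;
    rewrite tE ?mul1n ?eqxx ?orbT //; exfalso.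
  + have qE : q = 2 * n + 1 by apply: q_uniq; lia.
    by move: z_eq; rewrite qE tE nE /=; lia.
  + have qE : q = 3 by apply: q_uniq; lia.
    have hE : t./2 = 6 * a + 1 by lia.
    by move: z_eq; rewrite qE hE nE; lia.
  + have qE : q = n + 1 by apply: q_uniq; lia.
    by move: z_eq; rewrite qE tE nE /=; lia.
  + have qE : q = 2 by apply: q_uniq; lia.
    have hE : t./2 = 12 * a + 3 by lia.
    by move: z_eq; rewrite qE hE nE; lia.
(* For t = 1 and t = 2 the blocks are [n + 1, 2n] and [2n + 1, 3n]. *)
- rewrite !inE => /or4P[] /eqP tE; try by apply: prog; [lia | tauto].
    apply: (zz (2 * n) (6 * n + 1)); rewrite ?tE; try lia.
    move=> l l_gt0 l_le _; case: (leqP l n) => ?; first by constructor 1.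
    by case: (leqP l (2 * n)) => ?; [constructor 3 | constructor 2]; lia.
  apply: (zz (2 * n) (3 * n + 1)); rewrite ?tE; try lia.
  move=> l l_gt0 l_le /(_ 1) ?; case: (leqP l n) => ?; first by constructor 1.
  by case: (leqP l (2 * n)) => ?; [constructor 3 | constructor 2]; lia.
- move=> /IH_parity[t_dvd [q [z [qt z_eq]]]].
  have [s s6 t_s] := dvdn_6_prime hnp t_dvd.
  have [a nE] : exists a, n = 4 * a + 3 by exists (n %/ 4); lia.
  rewrite !inE; move: s6 t_s; rewrite !inE => /or4P[] /eqP-> [] tE;
    rewrite tE ?mul1n ?eqxx ?orbT //; exfalso.
  + have qE : q = 6 * n + 1 by apply: q_uniq; lia.
    by move: z_eq; rewrite qE tE nE /=; lia.
  + have qE : q = 3 * n + 1 by apply: q_uniq; lia.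
    by move: z_eq; rewrite qE tE nE /=; lia.
  + have qE : q = 3 by apply: q_uniq; lia.
    have hE : t./2 = 6 * a + 4 by lia.
    by move: z_eq; rewrite qE hE nE; lia.
  + have qE : q = 2 by apply: q_uniq; lia.
    have hE : t./2 = 12 * a + 9 by lia.
    by move: z_eq; rewrite qE hE nE; lia.
(* For t = 3 the blocks surround the multiple 2n + 1 of q = 2n + 1; for t = 6
   they surround the multiple 2n + 2 of q = n + 1, and n + 1 separates them
   from [1, n]. *)
rewrite !inE => /or4P[] /eqP tE; try by apply: prog; [lia | tauto].
  apply: (zz (2 * n + 1) (2 * n + 1)); rewrite ?tE; try lia.
  move=> l l_gt0 l_le /(_ 1) ?; case: (leqP l n) => ?; first by constructor 1.
  by case: (leqP l (2 * n)) => ?; [constructor 3 | constructor 2]; lia.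
apply: (zz (2 * n + 2) (n + 1)); rewrite ?tE; try lia.
move=> l l_gt0 l_le nd; have := nd 1; have := nd 2; have := nd 3.
move=> ? ? ?; case: (leqP l n) => ?; first by constructor 1.
by case: (leqP l (2 * n + 1)) => ?; [constructor 3 | constructor 2]; lia.
Qed.
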